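(* Let $(\mathcal{X},\mathcal{Y},\ell,S)$ be a Blackwell instance with $\mathcal{X}\subset\mathbb{R}^n_+$, $\mathcal{Y}\subset\mathbb{R}^m_+$, $S\subset\mathbb{R}^d$ compact and approachable, and $\ell\ge0$ coordinate-wise on $\mathbb{R}^n_+\times\mathbb{R}^m_+$. Let $\mathcal{O}_{\mathcal{X}}$ be an approximation oracle for $\mathcal{X}$ with ratio $\alpha_{\mathcal{X}}\ge1$. Put $\tilde S=\alpha_{\mathcal{X}}S$, $$G_{\mathcal{Y}}=(\alpha_{\mathcal{X}}+2)\|\ell\|R_{\mathcal{X}},\qquad G_1=\max_{s\in S,\ x\in\mathcal{B}((\alpha_{\mathcal{X}}+2)R_{\mathcal{X}}),\ y\in\mathcal{Y}}\|\alpha_{\mathcal{X}}s-\ell(x,y)\|.$$ Fix $T\ge1$, and let $N=\lceil G_{\mathcal{Y}}^2D_{\mathcal{Y}}^2T\rceil$, $\eta=\frac{2}{G_1\sqrt T}$, $\mu=\frac{D_{\mathcal{Y}}}{G_{\mathcal{Y}}\sqrt N}$. Consider the following algorithm. Start with an arbitrary $w_1\in\mathcal{B}(1)\subset\mathbb{R}^d$. For $t=1,\dots,T$: (1) Let $A_t=\sum_{i=1}^dw_t(i)L_i$. Choose an arbitrary $u_1\in\mathcal{Y}$, and for $i=1,\dots,N$ set $(p_i,q_i)=\widehat{\mathcal{O}_{\mathcal{X}}}(A_tu_i)$ and $u_{i+1}=\Pi_{\mathcal{Y}}(u_i+\mu A_t^\top p_i)$. Set $x_t=\frac1N\sum_{i=1}^Np_i$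 and $s_t=\frac1N\sum_{i=1}^Nq_i$. (2) Play $s_t\in\mathcal{X}$ and observe $y_t\in\mathcal{Y}$ chosen arbitrarily by the adversary. (3) Set $f_t(w)=h_{\tilde S}(w)-\langle w,\ell(x_t,y_t)\rangle$ and $w_{t+1}=\Pi_{\mathcal{B}(1)}(w_t-\eta\,\partial f_t(w_t))$, where $\partial f_t(w_t)$ is any subgradient of $f_t$ at $w_t$. Then, for every choice of $y_1,\dots,y_T\in\mathcal{Y}$ by the adversary, the average loss $\bar\ell_{s,T}=\frac1T\sum_{t=1}^T\ell(s_t,y_t)$ satisfies $$d\big(\bar\ell_{s,T},(\alpha_{\mathcal{X}}S)_{\downarrow}\big)\le\frac{6G_1+3}{2\sqrt T},$$ and the overall number of calls to $\mathcal{O}_{\mathcal{X}}$ is $O(G_{\mathcal{Y}}^2D_{\mathcal{Y}}^2T^2)$.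
   Context: **Blackwell instance.** A tuple $(\mathcal{X},\mathcal{Y},\ell,S)$ where $\mathcal{X}\subset\mathbb{R}^n$ and $\mathcal{Y}\subset\mathbb{R}^m$ are nonempty, convex and compact, $S\subset\mathbb{R}^d$ is nonempty, convex and closed, and $\ell:\mathbb{R}^n\times\mathbb{R}^m\to\mathbb{R}^d$ is bilinear. $S$ is approachable if there is an algorithm selecting $x_t\in\mathcal{X}$ as a function of $y_1,\dots,y_{t-1}$ such that for every sequence $(y_t)_{t\ge1}\subseteq\mathcal{Y}$, $d(\frac1T\sum_{t=1}^T\ell(x_t,y_t),S)\to0$ as $T\to\infty$. **Notation.** $\|\cdot\|$ is the Euclidean norm for vectors and the spectral norm for matrices; $d(\cdot,\cdot)$ is Euclidean distance from a point to a set; $\mathcal{B}(R)$ is the closed origin-centered Euclidean ball of radius $R$; $\Pi_K$ is Euclidean projection onto $K$; $h_K(w)=\sup_{k\in K}\langle w,k\rangle$; $(K)_{\downarrow}=\{y:\exists x\in K,\ y\le x\}$ (coordinate-wise). $R_{\mathcal{X}}\ge\max_{x\in\mathcal{X}}\|x\|$ and $D_{\mathcal{Y}}\ge\max_{y,y'\in\mathcal{Y}}\|y-y'\|$ are fixed upper bounds. $L_1,\dots,L_d\in\mathbb{R}^{n\times m}$ are the matrices with $[\ell(x,y)]_i=x^\top L_iy$ for all $x,y$, and $\|\ell\|:=\max_{u\in\mathcal{B}(1)}\|\sum_{i=1}^du(i)L_i\|$. The constants $G_{\mathcal{Y}},D_{\mathcal{Y}},G_1$ are assumed positive so that the step-sizes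 are well-defined. **Approximation oracle.** A map $\mathcal{O}_{\mathcal{X}}$ with $\mathcal{O}_{\mathcal{X}}(c)\in\mathcal{X}$ and $\langle\mathcal{O}_{\mathcal{X}}(c),c\rangle\le\alpha_{\mathcal{X}}\min_{x\in\mathcal{X}}\langle x,c\rangle$ for every $c\in\mathbb{R}^n_+$. **Extended approximation oracle.** For $c\in\mathbb{R}^n$ write $c=c^++c^-$ where $c^+$ agrees with $c$ on its nonnegative coordinates and is zero elsewhere, and $c^-$ agrees with $c$ on its negative coordinates and is zero elsewhere. For a vector $q$ let $\vec q=q/\|q\|$ if $q\ne0$ and $\vec q=0$ if $q=0$. Then $$\widehat{\mathcal{O}_{\mathcal{X}}}(c)=(v,s):=\big(\mathcal{O}_{\mathcal{X}}(c^+)-\alpha_{\mathcal{X}}R_{\mathcal{X}}\,\vec{c}^{\,-},\ \mathcal{O}_{\mathcal{X}}(c^+)\big),$$ where $\vec c^{\,-}$ is the normalization of $c^-$. **Number of calls.** $O(G_{\mathcal{Y}}^2D_{\mathcal{Y}}^2T^2)$ hides an absolute constant and is meant for $G_{\mathcal{Y}}^2D_{\mathcal{Y}}^2T\ge1$. *)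

(* Defs.v *)
From HB Require Import structures.
From mathcomp Require Import all_boot all_order all_algebra.
From mathcomp Require Import all_classical all_reals all_analysis.
Set Implicit Arguments.
Unset Strict Implicit.
Unset Printing Implicit Defensive.
Import Order.TTheory GRing.Theory Num.Theory.
Import numFieldNormedType.Exports.
Local Open Scope classical_set_scope.
Local Open Scope ring_scope.

(* Vectors are column matrices.  The library norm on matrices is the sup norm,
   so the Euclidean norm, and everything metric built on it, is defined here;
   [closed] and [compact] may be taken from the library, since the product
   topology on ['cV[R]_k] is the Euclidean one. *)
Section Euclidean.
Context {R : realType}.

Definition dotv k (x y : 'cV[R]_k) : R := \sum_(i < k) x i 0 * y i 0.

Definition enorm k (x : 'cV[R]_k) : R := Num.sqrt (dotv x x).

Definition eball k (r : R) : set 'cV[R]_k := [set x | enorm x <= r].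

Definition eucl_dist k (x : 'cV[R]_k) (K : set 'cV[R]_k) : R :=
  inf [set enorm (x - z) | z in K].

Definition is_eproj k (K : set 'cV[R]_k) (x p : 'cV[R]_k) : Prop :=
  K p /\ forall q, K q -> enorm (x - p) <= enorm (x - q).

(* Returns 0 when no nearest point exists, which cannot happen for nonempty
   closed [K]. *)
Definition eproj k (K : set 'cV[R]_k) (x : 'cV[R]_k) : 'cV[R]_k :=
  xget 0 [set p | is_eproj K x p].

Definition supportfun k (K : set 'cV[R]_k) (w : 'cV[R]_k) : R :=
  sup [set dotv w z | z in K].

Definition spectral_norm k p (M : 'M[R]_(k, p)) : R :=
  sup [set enorm (M *m v) | v in eball 1].

Definition scale_set k (a : R) (K : set 'cV[R]_k) : set 'cV[R]_k :=
  [set a *: z | z in K].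

Definition nonneg_vec k (x : 'cV[R]_k) : Prop := forall i, 0 <= x i 0.

Definition down_closure k (K : set 'cV[R]_k) : set 'cV[R]_k :=
  [set y | exists2 x, K x & forall i, y i 0 <= x i 0].

Definition is_subgradient k (f : 'cV[R]_k -> R) (w g : 'cV[R]_k) : Prop :=
  forall v, f w + dotv g (v - w) <= f v.

Definition pos_coords k (c : 'cV[R]_k) : 'cV[R]_k :=
  \col_i (if 0 <= c i 0 then c i 0 else 0).

Definition neg_coords k (c : 'cV[R]_k) : 'cV[R]_k :=
  \col_i (if c i 0 < 0 then c i 0 else 0).

Definition normalize_vec k (q : 'cV[R]_k) : 'cV[R]_k :=
  if q == 0 then 0 else (enorm q)^-1 *: q.

End Euclidean.

Section Blackwell.
Context {R : realType} {n m d : nat}.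
Implicit Types (X : set 'cV[R]_n) (Y : set 'cV[R]_m) (S : set 'cV[R]_d).

Record blackwell_instance X Y (l : {bilinear 'cV[R]_n -> 'cV[R]_m -> 'cV[R]_d})
    S : Prop := BlackwellInstance {
  bw_X_nonempty : X !=set0;
  bw_X_convex : convex_set X;
  bw_X_compact : compact X;
  bw_Y_nonempty : Y !=set0;
  bw_Y_convex : convex_set Y;
  bw_Y_compact : compact Y;
  bw_S_nonempty : S !=set0;
  bw_S_convex : convex_set S;
  bw_S_closed : closed S }.

(* [sigma] maps the moves played so far by the opponent to the next action;
   rounds are numbered from 0. *)
Definition approachable X Y (l : 'cV[R]_n -> 'cV[R]_m -> 'cV[R]_d) S : Prop :=
  exists2 sigma : seq 'cV[R]_m -> 'cV[R]_n,
    forall h, X (sigma h) &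
    forall y : nat -> 'cV[R]_m, (forall t, Y (y t)) ->
      (fun T : nat =>
         eucl_dist (T%:R^-1 *: \sum_(t < T) l (sigma (mkseq y t)) (y t)) S)
        @ \oo --> (0 : R).

Definition approx_oracle X (alpha : R) (O : 'cV[R]_n -> 'cV[R]_n) : Prop :=
  forall c, nonneg_vec c ->
    X (O c) /\ dotv (O c) c <= alpha * inf [set dotv x c | x in X].

Definition mxcomb (L : 'I_d -> 'M[R]_(n, m)) (u : 'cV[R]_d) : 'M[R]_(n, m) :=
  \sum_(i < d) u i 0 *: L i.

Definition loss_norm (L : 'I_d -> 'M[R]_(n, m)) : R :=
  sup [set spectral_norm (mxcomb L u) | u in eball 1].

End Blackwell.

(* Programs with access to an oracle from [Q] to [A], so that the number of
   oracle calls of an execution is a property of the program. *)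
Inductive oprog (Q A B : Type) : Type :=
| Ret of B
| Call of Q & (A -> oprog Q A B).

Arguments Ret {Q A B}.
Arguments Call {Q A B}.

Section OraclePrograms.
Context {Q A : Type}.

Fixpoint obind B C (p : oprog Q A B) (k : B -> oprog Q A C) : oprog Q A C :=
  match p with
  | Ret b => k b
  | Call q f => Call q (fun a => obind (f a) k)
  end.

Fixpoint orun (O : Q -> A) B (p : oprog Q A B) : B :=
  match p with
  | Ret b => b
  | Call q f => orun O (f (O q))
  end.

Fixpoint ocalls (O : Q -> A) B (p : oprog Q A B) : nat :=
  match p with
  | Ret _ => 0%N
  | Call q f => (ocalls O (f (O q))).+1
  end.

End OraclePrograms.

Section Algorithm.
Context {R : realType} {n m d : nat}.
Local Notation prog := (oprog 'cV[R]_n 'cV[R]_n).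

Definition ext_oracle (alpha RX : R) (c : 'cV[R]_n)
    : prog ('cV[R]_n * 'cV[R]_n)%type :=
  Call (pos_coords c) (fun o =>
    Ret (o - (alpha * RX) *: normalize_vec (neg_coords c), o)).

(* The pairs (p_i, q_i) of [k] successive steps started at [u]. *)
Fixpoint inner_loop (Y : set 'cV[R]_m) (alpha RX mu : R) (A : 'M[R]_(n, m))
    (k : nat) (u : 'cV[R]_m) : prog (seq ('cV[R]_n * 'cV[R]_n)) :=
  if k is k'.+1 then
    obind (ext_oracle alpha RX (A *m u)) (fun pq =>
    obind (inner_loop Y alpha RX mu A k' (eproj Y (u + mu *: (A^T *m pq.1))))
      (fun r => Ret (pq :: r)))
  else Ret [::].

(* The pair (x_t, s_t). *)
Definition inner_average (Y : set 'cV[R]_m) (alpha RX mu : R) (N : nat)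
    (A : 'M[R]_(n, m)) (u1 : 'cV[R]_m) : prog ('cV[R]_n * 'cV[R]_n)%type :=
  obind (inner_loop Y alpha RX mu A N u1) (fun r =>
    Ret (N%:R^-1 *: \sum_(pq <- r) pq.1, N%:R^-1 *: \sum_(pq <- r) pq.2)).

Definition surrogate (l : 'cV[R]_n -> 'cV[R]_m -> 'cV[R]_d) (St : set 'cV[R]_d)
    (x : 'cV[R]_n) (y : 'cV[R]_m) (w : 'cV[R]_d) : R :=
  supportfun St w - dotv w (l x y).

(* Rounds [t], ..., [t + k - 1] (numbered from 0), started at [w]; returns the
   actions s_t, ..., s_(t+k-1).  The arbitrary choices of round [t] are the
   starting point [u1 t], the opponent's move [y t] and the subgradient
   selected by [sg t]. *)
Fixpoint outer_loop (Y : set 'cV[R]_m)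
    (l : 'cV[R]_n -> 'cV[R]_m -> 'cV[R]_d) (L : 'I_d -> 'M[R]_(n, m))
    (St : set 'cV[R]_d) (alpha RX eta mu : R) (N : nat)
    (u1 : nat -> 'cV[R]_m) (y : nat -> 'cV[R]_m)
    (sg : nat -> ('cV[R]_d -> R) -> 'cV[R]_d -> 'cV[R]_d)
    (k t : nat) (w : 'cV[R]_d) : prog (seq 'cV[R]_n) :=
  if k is k'.+1 then
    obind (inner_average Y alpha RX mu N (mxcomb L w) (u1 t)) (fun xs =>
    obind (outer_loop Y l L St alpha RX eta mu N u1 y sg k' t.+1
             (eproj (eball 1)
                (w - eta *: sg t (surrogate l St xs.1 (y t)) w)))
      (fun r => Ret (xs.2 :: r)))
  else Ret [::].

End Algorithm.

(* Main.v *)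
Require Import Defs.
From HB Require Import structures.
From mathcomp Require Import all_boot all_order all_algebra.
From mathcomp Require Import all_classical all_reals all_analysis.
From mathcomp Require Import ring lra.
Import Order.TTheory GRing.Theory Num.Theory.
Import numFieldNormedType.Exports.
Local Open Scope classical_set_scope.
Local Open Scope ring_scope.

(** Two gradient methods are nested, and the oracle is used through one
    property of its extension: for the vectors [(p, q)] that it returns on [c],
    [<p, c>] is at most [alpha <x, c>] for all [x] in [X], and [q <= p]
    coordinatewise ([ext_oracleP]).

    A learner facing a constant [y] can approach [S], so for each [y] in [Y] and
    each direction [w] some [x] in [X] has [<w, l x y>] at most [h_S w], up to
    an arbitrarily small error ([approachable_response]).  With [A] the matrix
    of [<w, l x y> = <x, A y>] this says that [alpha min_x <x, A u>] is at most
    [h_(alpha S) w] for every [u] in [Y]; hence so is [<p_i, A u_i>] at every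
    inner iterate.  The [u_i] run projected gradient ascent on the linear
    functions [<p_i, A u>], and low regret turns these bounds along the
    trajectory into a bound against every fixed [y]: the average [x_t] of the
    [p_i] satisfies [<w_t, l x_t y> <= h_(alpha S) w_t + DY GY / sqrt N] for all
    [y] in [Y] ([inner_averageP]).  The number [N] of steps makes the error at
    most [1 / sqrt T].

    So whatever the opponent plays, the surrogate
    [f_t w = h_(alpha S) w - <w, l x_t y_t>] is at least [- 1 / sqrt T] at the
    current dual point [w_t].  The [w_t] run projected gradient descent on the
    [f_t], whose subgradients are bounded by [G1], and low regret again gives a
    lower bound at every fixed [w] of the unit ball: the average of the [f_t]
    at [w] is at least [- (2 G1 + 1) / sqrt T] ([outer_loopP]).  By duality
    ([dist_le_of_support]) the average of [l x_t y_t] is within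
    [(2 G1 + 1) / sqrt T] of [alpha S].

    The points that are played are not the [x_t] but the averages [s_t] of the
    oracle answers [q_i], which lie in [X] and below [x_t].  As the loss is
    monotone on nonnegative vectors, [l s_t y_t <= l x_t y_t], and passing to
    the downward closure of [alpha S] absorbs the difference
    ([eucl_dist_down_closure_le]). *)

Set Implicit Arguments.
Unset Strict Implicit.
Unset Printing Implicit Defensive.

(** * Euclidean geometry of column vectors *)

Section EuclideanGeometry.
Context {R : realType} {k : nat}.
Implicit Types (x y z w g : 'cV[R]_k) (K : set 'cV[R]_k) (a t : R).

Lemma dotvC x y : dotv x y = dotv y x.
Proof. by apply: eq_bigr => i _; rewrite mulrC. Qed.

Lemma dotvDl x y z : dotv (x + y) z = dotv x z + dotv y z.
Proof. by rewrite -big_split; apply: eq_bigr => i _; rewrite mxE mulrDl. Qed.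

Lemma dotvZl a x y : dotv (a *: x) y = a * dotv x y.
Proof. by rewrite mulr_sumr; apply: eq_bigr => i _; rewrite mxE mulrA. Qed.

Lemma dotvNl x y : dotv (- x) y = - dotv x y.
Proof. by rewrite -scaleN1r dotvZl mulN1r. Qed.

Lemma dotvBl x y z : dotv (x - y) z = dotv x z - dotv y z.
Proof. by rewrite dotvDl dotvNl. Qed.

Lemma dotv0l x : dotv 0 x = 0.
Proof. by rewrite -(scale0r (0 : 'cV[R]_k)) dotvZl mul0r. Qed.

Lemma dotvDr x y z : dotv z (x + y) = dotv z x + dotv z y.
Proof. by rewrite !(dotvC z) dotvDl. Qed.

Lemma dotvZr a x y : dotv x (a *: y) = a * dotv x y.
Proof. by rewrite !(dotvC x) dotvZl. Qed.

Lemma dotvNr x y : dotv x (- y) = - dotv x y.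
Proof. by rewrite !(dotvC x) dotvNl. Qed.

Lemma dotvBr x y z : dotv z (x - y) = dotv z x - dotv z y.
Proof. by rewrite dotvDr dotvNr. Qed.

Lemma dotv_sqB x y :
  dotv (x - y) (x - y) = dotv x x - 2 * dotv x y + dotv y y.
Proof. by rewrite !(dotvBl, dotvBr) (dotvC y x); ring. Qed.

Lemma dotv_suml (I : Type) (s : seq I) (F : I -> 'cV[R]_k) y :
  dotv (\sum_(i <- s) F i) y = \sum_(i <- s) dotv (F i) y.
Proof.
elim: s => [|i s IH]; first by rewrite !big_nil dotv0l.
by rewrite !big_cons dotvDl IH.
Qed.

Lemma dotv_sumr (I : Type) (s : seq I) (F : I -> 'cV[R]_k) y :
  dotv y (\sum_(i <- s) F i) = \sum_(i <- s) dotv y (F i).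
Proof. by rewrite dotvC dotv_suml; apply: eq_bigr => i _; rewrite dotvC. Qed.

Lemma dotv_ge0 x : 0 <= dotv x x.
Proof. by apply: sumr_ge0 => i _; rewrite -expr2 sqr_ge0. Qed.

Lemma dotv_eq0 x : dotv x x = 0 -> x = 0.
Proof.
move=> /eqP; rewrite psumr_eq0; last by move=> i _; rewrite -expr2 sqr_ge0.
move=> /allP h; apply/colP => i; rewrite mxE; apply/eqP.
by have := h i (mem_index_enum i); rewrite /= -expr2 sqrf_eq0.
Qed.

Lemma enorm_ge0 x : 0 <= enorm x.
Proof. exact: sqrtr_ge0. Qed.

Lemma enorm_sqr x : enorm x ^+ 2 = dotv x x.
Proof. by rewrite sqr_sqrtr // dotv_ge0. Qed.

Lemma enorm_le x a : 0 <= a -> (enorm x <= a) = (dotv x x <= a ^+ 2).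
Proof.
by move=> a0; rewrite -enorm_sqr ler_pXn2r // nnegrE // enorm_ge0.
Qed.

Lemma enorm0 : enorm (0 : 'cV[R]_k) = 0.
Proof. by rewrite /enorm dotv0l sqrtr0. Qed.

Lemma enorm_eq0 x : enorm x = 0 -> x = 0.
Proof. by move=> h; apply: dotv_eq0; rewrite -enorm_sqr h expr0n. Qed.

Lemma enormZ a x : enorm (a *: x) = `|a| * enorm x.
Proof.
by rewrite /enorm dotvZl dotvZr mulrA -expr2 sqrtrM ?sqr_ge0 // sqrtr_sqr.
Qed.

Lemma enormN x : enorm (- x) = enorm x.
Proof. by rewrite -scaleN1r enormZ normrN1 mul1r. Qed.

Lemma cauchy_schwarz x y : dotv x y <= enorm x * enorm y.
Proof.
have [x0|x0] := eqVneq (enorm x) 0.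
  by rewrite (enorm_eq0 x0) enorm0 dotv0l mul0r.
have xx0 : 0 < dotv x x by rewrite -enorm_sqr exprn_gt0 // lt_def x0 enorm_ge0.
(* the residual of y after projection onto the line of x *)
have := dotv_ge0 (dotv x x *: y - dotv x y *: x).
rewrite !(dotvBl, dotvBr, dotvZl, dotvZr) (dotvC y x).
rewrite (_ : _ - _ = dotv x x * (dotv x x * dotv y y - dotv x y ^+ 2)); last first.
  by ring.
rewrite pmulr_rge0 // subr_ge0 -!enorm_sqr -exprMn => h.
have [?|/ltW xy0] := lerP (dotv x y) 0.
  by rewrite (le_trans (y := 0)) // mulr_ge0 // enorm_ge0.
by move: h; rewrite ler_pXn2r // nnegrE // mulr_ge0 // enorm_ge0.
Qed.

Lemma enorm_triangle x y : enorm (x + y) <= enorm x + enorm y.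
Proof.
rewrite enorm_le ?addr_ge0 ?enorm_ge0 //.
rewrite dotvDl !dotvDr (dotvC y x) -!enorm_sqr.
by have := cauchy_schwarz x y; lra.
Qed.

Lemma dotv_normalize x : dotv (normalize_vec x) x = enorm x.
Proof.
rewrite /normalize_vec; case: eqP => [->|x0]; first by rewrite dotv0l enorm0.
rewrite dotvZl -enorm_sqr expr2 mulrA mulVf ?mul1r //.
by apply/eqP => /enorm_eq0.
Qed.

Lemma enorm_normalize x : enorm (normalize_vec x) <= 1.
Proof.
rewrite /normalize_vec; case: eqP => [_|x0]; first by rewrite enorm0.
rewrite enormZ ger0_norm ?invr_ge0 ?enorm_ge0 // mulVf //.
by apply/eqP => /enorm_eq0.
Qed.

Lemma convex_setP K : convex_set K <->
  (forall x y t, 0 <= t -> t <= 1 -> K x -> K y -> K (t *: x + (1 - t) *: y)).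
Proof.
split=> [cK x y t t0 t1 Kx Ky|cK x y t].
  have := cK x y (Itv01 t0 t1).
  by rewrite !inE; apply.
by rewrite !inE => Kx Ky; apply: (cK x y t%:num).
Qed.

Lemma convex_mean K (s : seq 'cV[R]_k) : convex_set K -> (0 < size s)%N ->
  {in s, forall x, K x} -> K ((size s)%:R^-1 *: \sum_(x <- s) x).
Proof.
move=> /convex_setP cK; elim: s => // x [|y s] IH _ Ks.
  by rewrite big_seq1 invr1 scale1r; apply: Ks; rewrite inE.
set s' := y :: s in IH Ks *; rewrite big_cons.
have n0 : (size s')%:R != 0 :> R by rewrite pnatr_eq0.
have n1 : 1 + (size s')%:R != 0 :> R by rewrite nat1r pnatr_eq0.
have := cK x ((size s')%:R^-1 *: \sum_(x <- s') x) (size (x :: s'))%:R^-1.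
rewrite scalerA.
have -> : (1 - (size (x :: s'))%:R^-1) * (size s')%:R^-1
        = (size (x :: s'))%:R^-1 :> R.
  rewrite -[size (x :: s')]/((size s').+1) -nat1r.
  by field; rewrite n0 n1.
rewrite -scalerDr; apply.
- by rewrite invr_ge0.
- by rewrite invf_le1 ?ltr0n // ler1n.
- by apply: Ks; rewrite inE eqxx.
- by apply: IH => // z zs; apply: Ks; rewrite inE zs orbT.
Qed.

Lemma convex_eball (r : R) : convex_set (@eball R k r).
Proof.
apply/convex_setP => x y t t0 t1 xr yr; rewrite /eball /=.
apply: (le_trans (enorm_triangle _ _)).
rewrite !enormZ !ger0_norm ?subr_ge0 //.
have -> : r = t * r + (1 - t) * r by ring.
by apply: lerD; apply: ler_wpM2l => //; rewrite subr_ge0.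
Qed.

Lemma continuous_dotv w : continuous (dotv w : 'cV[R]_k -> R).
Proof.
apply: continuous_big => [|i _ x]; first exact: add_continuous.
exact: (@cvgM R 'cV[R]_k (nbhs x) _ (fun=> w i 0) (fun z => z i 0) _ _
  (cvg_cst _) (@coord_continuous R k 1 i 0 x)).
Qed.

Lemma continuous_sqdist x :
  continuous ((fun z => dotv (x - z) (x - z)) : 'cV[R]_k -> R).
Proof.
apply: continuous_big => [|i _ z]; first exact: add_continuous.
have c : (fun y : 'cV[R]_k => (x - y) i 0) @ nbhs z --> (x - z) i 0.
  rewrite !mxE (_ : (fun y => _) = (fun y : 'cV[R]_k => x i 0 - y i 0)).
    exact: (@cvgB R R^o 'cV[R]_k (nbhs z) _ (fun=> x i 0) (fun y => y i 0) _ _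
      (cvg_cst _) (@coord_continuous R k 1 i 0 z)).
  by apply/funext => y; rewrite !mxE.
exact: (@cvgM R 'cV[R]_k (nbhs z) _ _ _ _ _ c c).
Qed.

Lemma is_eproj_eproj K x : (exists p, is_eproj K x p) -> is_eproj K x (eproj K x).
Proof. by move=> /(xgetPex 0). Qed.

Lemma eproj_compact K x : compact K -> K !=set0 -> is_eproj K x (eproj K x).
Proof.
move=> cK K0; apply: is_eproj_eproj.
have [p pK h] := compact_EVT_min K0 cK
  (continuous_subspaceT (@continuous_sqdist x)).
exists p; split; first by move: pK; rewrite inE.
move=> q Kq; rewrite enorm_le ?enorm_ge0 // enorm_sqr.
by apply: h; rewrite inE.
Qed.

Lemma eproj_eball1 x : is_eproj (eball 1) x (eproj (eball 1) x).
Proof.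
apply: is_eproj_eproj; have [x1|x1] := leP (enorm x) 1.
  by exists x; split => // q _; rewrite subrr enorm0 enorm_ge0.
have x0 : 0 < enorm x by apply: lt_trans x1.
exists ((enorm x)^-1 *: x); split.
  by rewrite /eball /= enormZ ger0_norm ?invr_ge0 ?(ltW x0) // mulVf // gt_eqF.
move=> q q1; rewrite /eball /= in q1.
rewrite -[X in X - _]scale1r -scalerBl enormZ ger0_norm; last first.
  by rewrite subr_ge0 invf_le1 // ltW.
rewrite mulrBl mul1r mulVf ?gt_eqF //.
have := enorm_triangle (x - q) q; rewrite subrK; lra.
Qed.

(** First-order optimality of the nearest point: moving from [p] a fraction [t]
    towards [q] changes the squared distance by [- 2 t a + t ^ 2 b], which
    would be negative for small [t] if [a] were positive. *)
Lemma eproj_obtuse K x p q : convex_set K -> is_eproj K x p -> K q ->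
  dotv (x - p) (q - p) <= 0.
Proof.
move=> /convex_setP cK [Kp hp] Kq; rewrite leNgt; apply/negP.
set a := dotv (x - p) (q - p) => a0; pose b := dotv (q - p) (q - p).
have key t : 0 <= t -> t <= 1 -> 2 * t * a <= t ^+ 2 * b.
  move=> t0 t1; have := hp _ (cK q p t t0 t1 Kq Kp).
  rewrite enorm_le ?enorm_ge0 // enorm_sqr.
  have -> : x - (t *: q + (1 - t) *: p) = (x - p) - t *: (q - p).
    by apply/colP => i; rewrite !mxE; ring.
  rewrite [X in _ <= X]dotv_sqB !dotvZl !dotvZr -/a -/b; nra.
have b0 : 2 * a <= b by have := key 1 ler01 (lexx _); lra.
have bp : 0 < b by lra.
have := key (a / b); rewrite divr_ge0 ?(ltW a0) ?(ltW bp) // ler_pdivrMr //.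
move=> /(_ isT); have -> : a <= 1 * b by lra.
move=> /(_ isT).
have -> : (a / b) ^+ 2 * b = a ^+ 2 / b by field; rewrite gt_eqF.
have -> : 2 * (a / b) * a = 2 * (a ^+ 2 / b) by field; rewrite gt_eqF.
have : 0 < a ^+ 2 / b by rewrite divr_gt0 // exprn_gt0.
lra.
Qed.

(** The potential argument behind projected gradient descent: projecting onto
    a convex set does not move the iterate away from any [z] of that set. *)
Lemma projected_step K (eta : R) g w w' z : convex_set K ->
  is_eproj K (w - eta *: g) w' -> K z ->
  2 * eta * dotv g (w - z)
    <= dotv (w - z) (w - z) - dotv (w' - z) (w' - z) + eta ^+ 2 * dotv g g.
Proof.
move=> cK hw' Kz; have := eproj_obtuse cK hw' Kz.
set v := w - eta *: g => obt.
have : dotv (w' - z) (w' - z) <= dotv (v - z) (v - z).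
  have -> : v - z = (v - w') - (z - w') by rewrite opprB addrA subrK.
  rewrite [X in _ <= X]dotv_sqB.
  have -> : dotv (z - w') (z - w') = dotv (w' - z) (w' - z).
    by rewrite -(opprB w' z) dotvNl dotvNr opprK.
  by have := dotv_ge0 (v - w'); lra.
have -> : v - z = (w - z) - eta *: g by rewrite /v addrAC.
rewrite (dotv_sqB (w - z)) !dotvZl !dotvZr (dotvC (w - z) g); lra.
Qed.

Lemma supportfun_attained K w : compact K -> K !=set0 ->
  exists2 z, K z & supportfun K w = dotv w z.
Proof.
move=> cK K0.
have [z zK h] := compact_EVT_max K0 cK
  (continuous_subspaceT (@continuous_dotv w)).
exists z; first by move: zK; rewrite inE.
have Kz : K z by move: zK; rewrite inE.
have ub : ubound [set dotv w z | z in K] (dotv w z).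
  by move=> _ [q Kq <-]; apply: h; rewrite inE.
apply/eqP; rewrite eq_le ge_sup //=; last by exists (dotv w z), z.
by apply: ub_le_sup; [exists (dotv w z) | exists z].
Qed.

Lemma dotv_le_supportfun K w z : compact K -> K z ->
  dotv w z <= supportfun K w.
Proof.
move=> cK Kz; have K0 : K !=set0 by exists z.
have [p pK h] := compact_EVT_max K0 cK
  (continuous_subspaceT (@continuous_dotv w)).
apply: ub_le_sup; last by exists z.
by exists (dotv w p) => _ [q Kq <-]; apply: h; rewrite inE.
Qed.

(** Dual description of the distance: the unit vector from the projection of
    [x] towards [x] is the [w] for which [<w, x> - h_K w] is the distance. *)
Lemma dist_le_of_support K x (c : R) : compact K -> K !=set0 -> convex_set K ->
  0 <= c -> (forall w, eball 1 w -> dotv w x - supportfun K w <= c) ->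
  exists2 z, K z & enorm (x - z) <= c.
Proof.
move=> cK K0 cvK c0 hw; have pz := eproj_compact x cK K0.
set z := eproj K x in pz; have [Kz _] := pz; exists z => //.
have [p Kp hp] := supportfun_attained (normalize_vec (x - z)) cK K0.
have := hw _ (enorm_normalize (x - z)); rewrite hp.
have : dotv (normalize_vec (x - z)) (p - z) <= 0.
  rewrite /normalize_vec; case: eqP => _; first by rewrite dotv0l.
  by rewrite dotvZl mulr_ge0_le0 ?invr_ge0 ?enorm_ge0 // (eproj_obtuse cvK pz).
rewrite -[X in _ -> _ -> X <= c]dotv_normalize.
rewrite !(dotvBr _ _ (normalize_vec (x - z))); lra.
Qed.

End EuclideanGeometry.

(** * Operator norms and the matrices of the loss *)

Section OperatorNorms.
Context {R : realType}.

(** By convention [sup] is 0 on sets that are empty or unbounded, so a positive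
    value certifies that it is a genuine least upper bound.  This is how the
    positivity of [loss_norm L] and [G1] makes them actual bounds. *)
Lemma le_sup_gt0 (E : set R) r : 0 < sup E -> E r -> r <= sup E.
Proof.
move=> sE Er; have [hs|/sup_out h] := pselect (has_sup E).
  exact: sup_upper_bound.
by move: sE; rewrite h ltxx.
Qed.

Lemma dotvE k (x y : 'cV[R]_k) : dotv x y = (x^T *m y) 0 0.
Proof. by rewrite mxE; apply: eq_bigr => i _; rewrite mxE. Qed.

Lemma dotv_mulmx p q (A : 'M[R]_(p, q)) x y :
  dotv x (A *m y) = dotv (A^T *m x) y.
Proof. by rewrite !dotvE trmx_mul trmxK mulmxA. Qed.

Lemma spectral_norm_has_ubound p q (A : 'M[R]_(p, q)) :
  has_ubound [set enorm (A *m v) | v in eball 1].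
Proof.
exists (Num.sqrt (\sum_i enorm (row i A)^T ^+ 2)) => _ [v v1 <-].
rewrite /eball /= in v1.
apply: ler_wsqrtr; rewrite /dotv; apply: ler_sum => i _; rewrite -expr2.
have -> : (A *m v) i 0 = dotv (row i A)^T v.
  by rewrite mxE; apply: eq_bigr => j _; rewrite !mxE.
rewrite -[X in X <= _]real_normK ?num_real //.
rewrite ler_pXn2r ?nnegrE ?normr_ge0 ?enorm_ge0 //.
have bound w : enorm w <= 1 -> dotv (row i A)^T w <= enorm (row i A)^T.
  move=> w1; apply: le_trans (cauchy_schwarz _ _) _.
  by rewrite ler_piMr // enorm_ge0.
rewrite ler_norml bound // andbT lerNl -dotvNr bound //.
by rewrite enormN.
Qed.

Lemma enorm_mulmx_le p q (A : 'M[R]_(p, q)) v :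
  enorm (A *m v) <= spectral_norm A * enorm v.
Proof.
have [->|v0] := eqVneq v 0; first by rewrite mulmx0 !enorm0 mulr0.
have nv : 0 < enorm v.
  by rewrite lt_def enorm_ge0 andbT; apply: contraNneq v0 => /enorm_eq0 ->.
rewrite -ler_pdivrMr // mulrC -[X in X * _]ger0_norm ?invr_ge0 ?(ltW nv) //.
rewrite -enormZ scalemxAr.
apply: ub_le_sup; first exact: spectral_norm_has_ubound.
exists ((enorm v)^-1 *: v) => //.
by rewrite /eball /= enormZ ger0_norm ?invr_ge0 ?(ltW nv) // mulVf ?gt_eqF.
Qed.

Lemma spectral_norm_ge0 p q (A : 'M[R]_(p, q)) : 0 <= spectral_norm A.
Proof.
apply: ub_le_sup; first exact: spectral_norm_has_ubound.
exists 0; last by rewrite mulmx0 enorm0.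
by rewrite /eball /= enorm0.
Qed.

(** Since [|A^T x|^2 = <x, A (A^T x)>], the norm of [A] also controls its
    transpose, which is what maps the points [p] to gradients on [Y]. *)
Lemma enorm_trmx_mulmx_le p q (A : 'M[R]_(p, q)) x :
  enorm (A^T *m x) <= spectral_norm A * enorm x.
Proof.
have [->|ne] := eqVneq (enorm (A^T *m x)) 0.
  by rewrite mulr_ge0 ?enorm_ge0 // spectral_norm_ge0.
have np : 0 < enorm (A^T *m x) by rewrite lt_def ne enorm_ge0.
rewrite -(ler_pM2l np) -expr2 enorm_sqr -dotv_mulmx.
apply: le_trans (cauchy_schwarz _ _) _; rewrite mulrC mulrA.
apply: ler_wpM2r; rewrite ?enorm_ge0 // mulrC.
exact: enorm_mulmx_le.
Qed.

Context {n m d : nat} (L : 'I_d -> 'M[R]_(n, m)).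

Lemma spectral_norm_mxcomb_le w : 0 < loss_norm L -> eball 1 w ->
  spectral_norm (mxcomb L w) <= loss_norm L.
Proof. by move=> L0 w1; apply: le_sup_gt0 L0 _; exists w. Qed.

Lemma dotv_loss (l : 'cV[R]_n -> 'cV[R]_m -> 'cV[R]_d) w x y :
  (forall x y i, l x y i 0 = (x^T *m L i *m y) 0 0) ->
  dotv w (l x y) = dotv x (mxcomb L w *m y).
Proof.
move=> hL; rewrite [RHS]dotvE mulmxA /mxcomb mulmx_sumr mulmx_suml summxE.
apply: eq_bigr => i _.
by rewrite hL -scalemxAr -scalemxAl [RHS]mxE.
Qed.

End OperatorNorms.

(** * Oracle programs *)

Section Programs.
Context {Q A : Type} (O : Q -> A).

Lemma orun_obind B C (p : oprog Q A B) (k : B -> oprog Q A C) :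
  orun O (Defs.obind p k) = orun O (k (orun O p)).
Proof. by elim: p => //= q f IH; rewrite IH. Qed.

Lemma ocalls_obind B C (p : oprog Q A B) (k : B -> oprog Q A C) :
  ocalls O (Defs.obind p k) = (ocalls O p + ocalls O (k (orun O p)))%N.
Proof. by elim: p => //= q f IH; rewrite IH. Qed.

End Programs.

Section CallCounts.
Context {R : realType} {n m d : nat}.
Context (O : 'cV[R]_n -> 'cV[R]_n) (Y : set 'cV[R]_m) (alpha RX mu eta : R).

Lemma ocalls_inner_loop (A : 'M[R]_(n, m)) k u :
  ocalls O (inner_loop Y alpha RX mu A k u) = k.
Proof.
elim: k u => //= k IH u.
by rewrite ocalls_obind IH addn0.
Qed.

Lemma ocalls_outer_loop (l : 'cV[R]_n -> 'cV[R]_m -> 'cV[R]_d)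
    (L : 'I_d -> 'M[R]_(n, m)) St N u1 y sg k t w :
  ocalls O (outer_loop Y l L St alpha RX eta mu N u1 y sg k t w) = (k * N)%N.
Proof.
elim: k t w => //= k IH t w.
by rewrite !ocalls_obind ocalls_inner_loop IH /= !addn0 mulSn.
Qed.

End CallCounts.

(** * The extended oracle *)

Section ExtendedOracle.
Context {R : realType} {n : nat} (X : set 'cV[R]_n) (alpha RX : R)
  (O : 'cV[R]_n -> 'cV[R]_n).
Context (hX : forall x, X x -> nonneg_vec x)
  (hRX : forall x, X x -> enorm x <= RX) (halpha : 1 <= alpha)
  (hO : approx_oracle X alpha O).

Lemma nonneg_pos_coords (c : 'cV[R]_n) : nonneg_vec (pos_coords c).
Proof. by move=> i; rewrite mxE; case: ifP. Qed.

Lemma pos_neg_coordsE (c : 'cV[R]_n) : c = pos_coords c + neg_coords c.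
Proof.
by apply/colP => i; rewrite !mxE; case: leP; rewrite ?addr0 ?add0r.
Qed.

Lemma dotv_neg_pos_coords (c : 'cV[R]_n) :
  dotv (neg_coords c) (pos_coords c) = 0.
Proof.
by apply: big1 => i _; rewrite !mxE; case: leP; rewrite ?mul0r ?mulr0.
Qed.

Lemma normalize_neg_coords_le0 (c : 'cV[R]_n) i :
  normalize_vec (neg_coords c) i 0 <= 0.
Proof.
rewrite /normalize_vec; case: eqP => _; first by rewrite mxE.
rewrite mxE mulr_ge0_le0 ?invr_ge0 ?enorm_ge0 // mxE.
by case: ltP => // /ltW.
Qed.

(** On the negative part of [c], where the oracle gives no guarantee, the
    correction [- alpha RX c^-/|c^-|] contributes [- alpha RX |c^-|], which by
    Cauchy-Schwarz is below [alpha <x, c^->] for every [x] in [X]; and the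
    oracle point itself has a nonpositive product with [c^-]. *)
Lemma ext_oracleP c : let: (p, q) := orun O (ext_oracle alpha RX c) in
  [/\ X q, enorm p <= (alpha + 1) * RX, forall i, q i 0 <= p i 0 &
      forall x, X x -> dotv p c <= alpha * dotv x c].
Proof.
rewrite /=; have [Xo ho] := hO (nonneg_pos_coords c).
set o := O _ in Xo ho *; set v := normalize_vec _.
have R0 : 0 <= RX by apply: le_trans (enorm_ge0 o) (hRX Xo).
have a0 : 0 <= alpha by apply: le_trans halpha.
have aR0 : 0 <= alpha * RX by apply: mulr_ge0.
split=> //.
- apply: le_trans (enorm_triangle _ _) _.
  rewrite enormN enormZ ger0_norm // mulrDl mul1r addrC lerD ?hRX //.
  by rewrite ler_piMr // enorm_normalize.
- move=> i; rewrite !mxE lerDl oppr_ge0 mulr_ge0_le0 //.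
  exact: normalize_neg_coords_le0.
move=> x Xx; have xo : dotv o (pos_coords c) <= alpha * dotv x (pos_coords c).
  apply: le_trans ho _; apply: ler_wpM2l => //; apply: ge_inf; last by exists x.
  exists 0 => _ [z Xz <-]; apply: sumr_ge0 => i _.
  by rewrite mulr_ge0 // ?nonneg_pos_coords // hX.
rewrite [X in dotv _ X <= _]pos_neg_coordsE [X in _ <= _ * dotv _ X]pos_neg_coordsE.
rewrite !(dotvDr _ _ (o - _)) !(dotvDr _ _ x) !dotvBl !dotvZl.
have -> : dotv v (pos_coords c) = 0.
  rewrite /v /normalize_vec; case: eqP => _; first by rewrite dotv0l.
  by rewrite dotvZl dotv_neg_pos_coords mulr0.
rewrite dotv_normalize.
have on : dotv o (neg_coords c) <= 0.
  apply: sumr_le0 => i _; rewrite mulr_ge0_le0 ?hX // mxE.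
  by case: ltP => // /ltW.
have : - (alpha * RX) * enorm (neg_coords c) <= alpha * dotv x (neg_coords c).
  have := cauchy_schwarz (- x) (neg_coords c); rewrite dotvNl enormN.
  have := ler_wpM2r (enorm_ge0 (neg_coords c)) (hRX Xx).
  move=> h1 h2; rewrite -mulrN -mulrA ler_wpM2l //; lra.
lra.
Qed.

End ExtendedOracle.

(** * Consequences of approachability *)

Section Response.
Context {R : realType} {n m d : nat} (X : set 'cV[R]_n) (Y : set 'cV[R]_m)
  (l : {bilinear 'cV[R]_n -> 'cV[R]_m -> 'cV[R]_d}) (S : set 'cV[R]_d).

(** Against the constant sequence [y, y, ...] the average loss of an
    approaching strategy is the loss of its average action, which lies in [X]
    and whose loss is therefore arbitrarily close to [S]. *)
Lemma approachable_response y w (e : R) : convex_set X -> S !=set0 ->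
  approachable X Y l S -> Y y -> 0 < e ->
  exists2 x, X x & exists2 z, S z & dotv w (l x y) <= dotv w z + e.
Proof.
move=> cX [z0 Sz0] [sigma Xs happ] Yy e0.
have := happ (fun=> y) (fun=> Yy) => /cvgr0Pnorm_lt.
have w1 : 0 < enorm w + 1 by have := enorm_ge0 w; lra.
move=> /(_ (e / (enorm w + 1))); rewrite divr_gt0 // => /(_ isT)[N _ /(_ N.+1)].
move=> /(_ (leqnSn N)) /= /(le_lt_trans (ler_norm _)).
set s := fun t : 'I_N.+1 => sigma (mkseq (fun=> y) t).
pose xs := [seq s t | t <- enum 'I_N.+1].
have sxs : size xs = N.+1 by rewrite size_map size_enum_ord.
have Xm : X (N.+1%:R^-1 *: \sum_(t < N.+1) s t).
  have := @convex_mean R n X xs cX; rewrite sxs big_map big_enum /=; apply=> //.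
  by move=> _ /mapP[t _ ->]; apply: Xs.
have -> : N.+1%:R^-1 *: \sum_(t < N.+1) l (s t) y
    = l (N.+1%:R^-1 *: \sum_(t < N.+1) s t) y.
  by rewrite linearZl_LR linear_sumlz.
set x := _ *: _ in Xm *; move=> /inf_lt[]; first by exists (enorm (l x y - z0)), z0.
move=> _ [z Sz <-] hz; exists x => //; exists z => //.
rewrite -lerBlDl -dotvBr; apply: le_trans (cauchy_schwarz _ _) _.
apply: (@le_trans _ _ ((enorm w + 1) * (e / (enorm w + 1)))).
  by apply: ler_pM; rewrite ?enorm_ge0 ?lerDl // ltW.
by rewrite mulrCA divff ?mulr1 // gt_eqF.
Qed.

End Response.

(** * The inner loop: projected gradient ascent against the oracle *)

Section InnerLoop.
Context {R : realType} {n m : nat} (X : set 'cV[R]_n) (Y : set 'cV[R]_m)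
  (alpha RX mu G DY h : R) (O : 'cV[R]_n -> 'cV[R]_n) (A : 'M[R]_(n, m)).
Context (hX : forall x, X x -> nonneg_vec x) (cX : convex_set X)
  (hRX : forall x, X x -> enorm x <= RX) (halpha : 1 <= alpha)
  (hO : approx_oracle X alpha O)
  (cY : compact Y) (cvY : convex_set Y) (mu0 : 0 < mu)
  (hDY : forall y y', Y y -> Y y' -> enorm (y - y') <= DY)
  (hA : forall p, enorm p <= (alpha + 1) * RX -> enorm (A^T *m p) <= G)
  (hresp : forall u, Y u -> forall e, 0 < e ->
     exists2 x, X x & alpha * dotv x (A *m u) <= h + e).

(** The vectors [A^T p_i] are the gradients of the linear functions
    [u |-> <p_i, A u>], and the oracle keeps [<p_i, A u_i>] below [h], so the
    regret bound of gradient ascent caps [sum_i <p_i, A y>] for every [y]. *)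
Lemma inner_loopP k u : Y u ->
  let r := orun O (inner_loop Y alpha RX mu A k u) in
  [/\ size r = k,
      {in r, forall pq : 'cV[R]_n * 'cV[R]_n,
        [/\ X pq.2, enorm pq.1 <= (alpha + 1) * RX &
            forall i, pq.2 i 0 <= pq.1 i 0]} &
      forall y, Y y -> 2 * mu * \sum_(pq <- r) dotv pq.1 (A *m y)
        <= k%:R * (2 * mu * h + mu ^+ 2 * G ^+ 2) + dotv (u - y) (u - y)].
Proof.
elim: k u => [|k IH] u Yu /=.
  split=> // y Yy; rewrite big_nil mulr0 mul0r add0r; exact: dotv_ge0.
have := ext_oracleP hX hRX halpha hO (A *m u).
rewrite /=; set p := _ - _; set q := O _ => -[Xq np qp hp].
rewrite orun_obind /=; set u' := eproj _ _.
have hu' : is_eproj Y (u + mu *: (A^T *m p)) u'.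
  by apply: eproj_compact cY _; exists u.
have Yu' : Y u' by case: hu'.
have [sr hr hreg] := IH u' Yu'.
set r := orun O (inner_loop _ _ _ _ _ _ _) in sr hr hreg *.
split; first by rewrite /= sr.
  by move=> pq; rewrite inE => /predU1P[->|/hr].
move=> y Yy; rewrite big_cons /=.
have pu : dotv p (A *m u) <= h.
  apply/ler_addgt0Pr => e e0; have [x Xx hx] := hresp Yu e0.
  exact: le_trans (hp x Xx) hx.
have -> : dotv p (A *m y) = dotv p (A *m u) + dotv (- (A^T *m p)) (u - y).
  by rewrite !dotv_mulmx dotvNl dotvBr; ring.
have step : 2 * mu * dotv (- (A^T *m p)) (u - y)
    <= dotv (u - y) (u - y) - dotv (u' - y) (u' - y) + mu ^+ 2 * G ^+ 2.
  apply: le_trans (projected_step (g := - (A^T *m p)) cvY _ Yy) _.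
    by rewrite scalerN opprK; exact: hu'.
  rewrite lerD2l ler_wpM2l ?sqr_ge0 // dotvNl dotvNr opprK -enorm_sqr.
  have Ap := hA np; rewrite ler_pXn2r // ?nnegrE ?enorm_ge0 //.
  exact: le_trans (enorm_ge0 _) Ap.
have := hreg y Yy; rewrite mulrDr -natr1 => hr'.
have := ler_wpM2l (ltW mu0) pu; lra.
Qed.

Lemma inner_averageP N u : (0 < N)%N -> Y u ->
  let xs := orun O (inner_average Y alpha RX mu N A u) in
  [/\ X xs.2, enorm xs.1 <= (alpha + 1) * RX,
      forall i, xs.2 i 0 <= xs.1 i 0 &
      forall y, Y y -> dotv xs.1 (A *m y)
        <= h + (DY ^+ 2 / (N%:R * mu) + mu * G ^+ 2) / 2].
Proof.
move=> N0 Yu; rewrite /inner_average orun_obind.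
have [sr hr hreg] := inner_loopP N Yu.
set r := orun O _ in sr hr hreg *; rewrite /= -sr.
have mean (F : 'cV[R]_n * 'cV[R]_n -> 'cV[R]_n) K :
    convex_set K -> {in r, forall pq, K (F pq)} ->
    K ((size r)%:R^-1 *: \sum_(pq <- r) F pq).
  move=> cK hK; have := @convex_mean R n K [seq F pq | pq <- r] cK.
  rewrite size_map sr big_map; apply=> // _ /mapP[pq hpq ->]; exact: hK.
have rN : 0 < N%:R :> R by rewrite ltr0n.
split.
- by apply: (mean snd) => // pq /hr[].
- apply: (mean fst _ (@convex_eball R n ((alpha + 1) * RX))).
  by move=> pq /hr[].
- move=> i; rewrite !mxE ler_wpM2l ?invr_ge0 // !summxE.
  by rewrite !big_seq; apply: ler_sum => pq /hr[].
move=> y Yy; rewrite sr dotvZl dotv_suml ler_pdivrMl //.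
have hd : dotv (u - y) (u - y) <= DY ^+ 2.
  rewrite -enorm_le ?hDY //; exact: le_trans (enorm_ge0 _) (hDY Yu Yy).
have mu2 : 0 < 2 * mu by rewrite mulr_gt0.
rewrite -(ler_pM2l mu2).
have -> : 2 * mu * (N%:R * (h + (DY ^+ 2 / (N%:R * mu) + mu * G ^+ 2) / 2))
  = N%:R * (2 * mu * h + mu ^+ 2 * G ^+ 2) + DY ^+ 2.
  by field; rewrite !gt_eqF.
by apply: le_trans (hreg y Yy) _; rewrite lerD2l.
Qed.

End InnerLoop.

(** [D ^ 2 / (2 N mu) + mu G ^ 2 / 2] is the average regret of [N] steps of
    size [mu] on a set of diameter [D] with gradients bounded by [G]; this [mu]
    makes its two terms equal.  Both loops use it, the outer one with [D = 2],
    the diameter of the unit ball. *)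
Lemma balanced_step (R : realType) (D G N : R) : 0 < D -> 0 < G -> 0 < N ->
  let mu := D / (G * Num.sqrt N) in
  (D ^+ 2 / (N * mu) + mu * G ^+ 2) / 2 = D * G / Num.sqrt N.
Proof.
move=> D0 G0 N0 /=; rewrite -{1}(sqr_sqrtr (ltW N0)).
have s0 : 0 < Num.sqrt N by rewrite sqrtr_gt0.
by field; rewrite !gt_eqF.
Qed.

(** * The outer loop: online gradient descent on the dual variable *)

Section Surrogate.
Context {R : realType} {n m d : nat} (l : 'cV[R]_n -> 'cV[R]_m -> 'cV[R]_d)
  (St : set 'cV[R]_d).
Context (cSt : compact St) (St0 : St !=set0).

Lemma surrogate_has_subgradient x y w :
  exists g, is_subgradient (surrogate l St x y) w g.
Proof.
have [z Sz hz] := supportfun_attained w cSt St0.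
exists (z - l x y) => v; rewrite /surrogate hz.
have := dotv_le_supportfun v cSt Sz.
rewrite dotvBr !dotvBl !(dotvC _ w) !(dotvC _ v); lra.
Qed.

(** Testing the subgradient inequality at [w + g] bounds [|g|^2] by [<g, z - l x y>],
    where [z] attains the support function at [w + g]. *)
Lemma enorm_subgradient_le x y w g (G : R) :
  (forall z, St z -> enorm (z - l x y) <= G) ->
  is_subgradient (surrogate l St x y) w g -> enorm g <= G.
Proof.
move=> hG /(_ (w + g)); rewrite /surrogate.
have [z Sz ->] := supportfun_attained (w + g) cSt St0.
have := dotv_le_supportfun w cSt Sz.
rewrite [w + g - w]addrAC subrr add0r !dotvDl => hw hg.
have {hw hg} : dotv g g <= dotv g (z - l x y) by rewrite dotvBr; lra.
rewrite -enorm_sqr => /le_trans /(_ (cauchy_schwarz _ _)).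
have [-> _|g0] := eqVneq (enorm g) 0.
  by apply: le_trans (enorm_ge0 _) (hG z Sz).
rewrite expr2 ler_pM2l ?lt_def ?g0 ?enorm_ge0 // => h.
exact: le_trans h (hG z Sz).
Qed.

End Surrogate.

Section OuterLoop.
Context {R : realType} {n m d : nat} (X : set 'cV[R]_n) (Y : set 'cV[R]_m)
  (l : 'cV[R]_n -> 'cV[R]_m -> 'cV[R]_d) (L : 'I_d -> 'M[R]_(n, m))
  (St : set 'cV[R]_d) (alpha RX eta mu B G eps : R) (N : nat)
  (O : 'cV[R]_n -> 'cV[R]_n) (u1 y : nat -> 'cV[R]_m)
  (sg : nat -> ('cV[R]_d -> R) -> 'cV[R]_d -> 'cV[R]_d).
Context (eta0 : 0 < eta) (cSt : compact St) (St0 : St !=set0)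
  (hinner : forall w u, eball 1 w -> Y u ->
     let xs := orun O (inner_average Y alpha RX mu N (mxcomb L w) u) in
     [/\ X xs.2, enorm xs.1 <= B, forall i, xs.2 i 0 <= xs.1 i 0 &
         forall v, Y v -> dotv w (l xs.1 v) <= supportfun St w + eps])
  (hG : forall x v z, enorm x <= B -> Y v -> St z -> enorm (z - l x v) <= G)
  (hsg : forall t f w, (exists g, is_subgradient f w g) ->
     is_subgradient f w (sg t f w)).

(** The inner loop makes every surrogate loss at least [- eps] at the current
    iterate; low regret of gradient descent transfers this lower bound to the
    sum of the surrogates at every fixed [z] of the unit ball.  The auxiliary
    points [x i] are the averages of the vectors [p] of the inner loop, which
    the program does not return. *)
Lemma outer_loopP k t w : eball 1 w ->
  (forall i, (i < k)%N -> Y (u1 (t + i)%N) /\ Y (y (t + i)%N)) ->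
  let s := orun O (outer_loop Y l L St alpha RX eta mu N u1 y sg k t w) in
  exists x : nat -> 'cV[R]_n,
    (forall i, (i < k)%N ->
       [/\ X (nth 0 s i), enorm (x i) <= B &
           forall j, nth 0 s i j 0 <= x i j 0]) /\
    forall z, eball 1 z ->
      2 * eta * - (\sum_(i < k) surrogate l St (x i) (y (t + i)%N) z)
        <= k%:R * (2 * eta * eps + eta ^+ 2 * G ^+ 2) + dotv (w - z) (w - z).
Proof.
elim: k t w => [|k IH] t w w1 hY /=.
  exists (fun=> 0); split => // z _.
  by rewrite big_ord0 oppr0 mulr0 mul0r add0r dotv_ge0.
have [Yu Yy] := hY 0%N isT; rewrite addn0 in Yu Yy.
rewrite orun_obind; have := hinner w1 Yu.
set xs := orun O (inner_average _ _ _ _ _ _ _) => -[Xs nx sx hx].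
rewrite orun_obind /=; set f := surrogate l St xs.1 (y t).
set w' := eproj _ _.
have hw' : is_eproj (eball 1) (w - eta *: sg t f w) w' := eproj_eball1 _.
have w'1 : eball 1 w' by case: hw'.
have {}hY i : (i < k)%N -> Y (u1 (t.+1 + i)%N) /\ Y (y (t.+1 + i)%N).
  by move=> ik; rewrite addSnnS; apply: hY.
have [x [hs hreg]] := IH t.+1 w' w'1 hY.
exists (fun i => if i is i'.+1 then x i' else xs.1); split.
  by case=> [|i] //; rewrite ltnS => /hs.
move=> z z1; rewrite big_ord_recl /= addn0 -/f.
under eq_bigr do rewrite /bump /= add1n addnS -addSn.
have gsub : is_subgradient f w (sg t f w).
  by apply: hsg; apply: surrogate_has_subgradient.
have gG : enorm (sg t f w) <= G.
  by apply: enorm_subgradient_le gsub => // q Sq; apply: hG.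
have := projected_step (@convex_eball R d 1) hw' z1.
have gG2 : eta ^+ 2 * dotv (sg t f w) (sg t f w) <= eta ^+ 2 * G ^+ 2.
  rewrite ler_wpM2l ?sqr_ge0 // -enorm_le //; exact: le_trans (enorm_ge0 _) gG.
have fw : - eps <= f w by have := hx _ Yy; rewrite /f /surrogate; lra.
have := gsub z; rewrite -(opprB w z) dotvNr => fz.
have {fw fz} fz : - f z <= eps + dotv (sg t f w) (w - z) by lra.
have := ler_wpM2l (ltW eta0) fz.
have := hreg z z1; rewrite -natr1; set sm := \sum_(_ < _) _; lra.
Qed.

End OuterLoop.

(** * Number of steps, scaled sets and the final bound *)

Lemma natr_ceil_bounds (R : realType) (r : R) : 0 < r ->
  r <= (`|Num.ceil r|%N)%:R < r + 1.
Proof.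
move=> r0; have c0 : 0 <= Num.ceil r by rewrite ceil_ge0 (lt_trans _ r0) ?ltrN10.
rewrite natr_absz ger0_norm //; apply/andP; split; first exact: ceil_ge.
by rewrite -ltrBlDr; have := ceilB1_lt r; rewrite rmorphB.
Qed.

Lemma accuracy_of_steps (R : realType) (D G T N : R) :
  0 < D -> 0 < G -> 0 < T -> G ^+ 2 * D ^+ 2 * T <= N ->
  D * G / Num.sqrt N <= (Num.sqrt T)^-1.
Proof.
move=> D0 G0 T0 hN.
have N0 : 0 < N by apply: lt_le_trans hN; rewrite !mulr_gt0 ?exprn_gt0.
have sN : 0 < Num.sqrt N by rewrite sqrtr_gt0.
have sT : 0 < Num.sqrt T by rewrite sqrtr_gt0.
rewrite ler_pdivrMr // ler_pdivlMl //.
rewrite -(ler_pXn2r (ltn0Sn 1)) ?nnegrE ?mulr_ge0 ?(ltW sN, ltW sT, ltW D0, ltW G0) //.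
rewrite !exprMn !sqr_sqrtr ?(ltW N0, ltW T0) //; lra.
Qed.

Section ScaledSet.
Context {R : realType} {d : nat}.
Implicit Type S : set 'cV[R]_d.

Lemma compact_scale_set (a : R) S : compact S -> compact (scale_set a S).
Proof.
move=> cS; apply: continuous_compact => //.
exact/continuous_subspaceT/scaler_continuous.
Qed.

Lemma convex_scale_set (a : R) S : convex_set S -> convex_set (scale_set a S).
Proof.
move=> /convex_setP cS; apply/convex_setP => _ _ t t0 t1 [x Sx <-] [y Sy <-].
exists (t *: x + (1 - t) *: y); first exact: cS.
by rewrite scalerDr !scalerA !(mulrC a).
Qed.

(** Lowering the coordinates of a point cannot increase its distance to a
    downward closed set: the same translation lowers the nearest point. *)
Lemma eucl_dist_down_closure_le S (x x' z : 'cV[R]_d) : S z ->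
  (forall i, x' i 0 <= x i 0) -> eucl_dist x' (down_closure S) <= enorm (x - z).
Proof.
move=> Sz xx'; apply: ge_inf; first by exists 0 => _ [v _ <-]; exact: enorm_ge0.
exists (x' - (x - z)); last by rewrite opprB addrC subrK.
by exists z => // i; rewrite !mxE; have := xx' i; lra.
Qed.

End ScaledSet.

Theorem theorem5 (R : realType) :
  exists2 C : R, 0 < C &
  forall (n m d : nat)
    (X : set 'cV[R]_n) (Y : set 'cV[R]_m)
    (l : {bilinear 'cV[R]_n -> 'cV[R]_m -> 'cV[R]_d}) (S : set 'cV[R]_d)
    (L : 'I_d -> 'M[R]_(n, m))
    (alpha RX DY : R) (O : 'cV[R]_n -> 'cV[R]_n) (T : nat)
    (hB : blackwell_instance X Y l S)
    (hX : forall x, X x -> nonneg_vec x)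
    (hY : forall y, Y y -> nonneg_vec y)
    (hS : compact S)
    (happ : approachable X Y l S)
    (hl : forall x y, nonneg_vec x -> nonneg_vec y -> nonneg_vec (l x y))
    (hL : forall x y i, l x y i 0 = (x^T *m L i *m y) 0 0)
    (hRX : forall x, X x -> enorm x <= RX)
    (hDY : forall y y', Y y -> Y y' -> enorm (y - y') <= DY)
    (halpha : 1 <= alpha)
    (hO : approx_oracle X alpha O)
    (hT : (0 < T)%N),
  let St := scale_set alpha S in
  let GY : R := (alpha + 2) * loss_norm L * RX in
  let G1 : R := sup [set r | exists s x y,
                   [/\ S s, eball ((alpha + 2) * RX) x, Y y
                     & r = enorm (alpha *: s - l x y)]] in
  let N : nat := `|Num.ceil (GY ^+ 2 * DY ^+ 2 * T%:R)|%N in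
  let eta : R := 2 / (G1 * Num.sqrt T%:R) in
  let mu : R := DY / (GY * Num.sqrt N%:R) in
  0 < GY -> 0 < DY -> 0 < G1 ->
  forall (w1 : 'cV[R]_d) (u1 y : nat -> 'cV[R]_m)
    (sg : nat -> ('cV[R]_d -> R) -> 'cV[R]_d -> 'cV[R]_d)
    (hw1 : eball 1 w1)
    (hu1 : forall t, (t < T)%N -> Y (u1 t))
    (hy : forall t, (t < T)%N -> Y (y t))
    (hsg : forall t f w, (exists g, is_subgradient f w g) ->
             is_subgradient f w (sg t f w)),
  let algo := outer_loop Y l L St alpha RX eta mu N u1 y sg T 0 w1 in
  let s : nat -> 'cV[R]_n := nth 0 (orun O algo) in
  [/\ forall t, (t < T)%N -> X (s t),
      eucl_dist (T%:R^-1 *: \sum_(t < T) l (s t) (y t)) (down_closure St)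
        <= (6 * G1 + 3) / (2 * Num.sqrt T%:R)
    & 1 <= GY ^+ 2 * DY ^+ 2 * T%:R ->
      (ocalls O algo)%:R <= C * (GY ^+ 2 * DY ^+ 2 * T%:R ^+ 2)].
Proof.
(* the ceiling at most doubles a quantity that is at least 1 *)
exists 2; first exact: ltr0n.
move=> n m d X Y l S L alpha RX DY O T hB hX hY hS happ hl hL hRX hDY halpha hO hT.
move=> St GY G1 N eta mu GY0 DY0 G10 w1 u1 y sg hw1 hu1 hy hsg algo s.
case: hB => -[x0 Xx0] cvX _ Y0 cvY cY S0 cvS _.
have T0 : 0 < T%:R :> R by rewrite ltr0n.
have sT0 : 0 < Num.sqrt T%:R :> R by rewrite sqrtr_gt0.
have RX0 : 0 <= RX := le_trans (enorm_ge0 x0) (hRX x0 Xx0).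
have a0 : 0 < alpha by lra.
have cSt : compact St by exact: compact_scale_set.
have St0 : St !=set0 by case: S0 => z Sz; exists (alpha *: z), z.
have r0 : 0 < GY ^+ 2 * DY ^+ 2 * T%:R.
  by do 2!apply: mulr_gt0 => //; apply: exprn_gt0.
have /andP[Nge Nlt] := natr_ceil_bounds r0; rewrite -/N in Nge Nlt.
have NR0 : 0 < N%:R :> R := lt_le_trans r0 Nge.
have N0 : (0 < N)%N by rewrite -(ltr0n R).
have mu0 : 0 < mu by apply: divr_gt0 => //; apply: mulr_gt0; rewrite ?sqrtr_gt0.
have eta0 : 0 < eta by apply: divr_gt0 => //; apply: mulr_gt0.
have lossN : 0 < loss_norm L.
  rewrite ltNge; apply/negP => L0; move: GY0; rewrite ltNge => /negP; apply.
  by rewrite /GY -mulrA mulr_ge0_le0 ?mulr_le0_ge0 //; lra.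
pose B := (alpha + 1) * RX; pose eps : R := (Num.sqrt T%:R)^-1.
have hA w p : eball 1 w -> enorm p <= B -> enorm ((mxcomb L w)^T *m p) <= GY.
  move=> w_1 pB; apply: le_trans (enorm_trmx_mulmx_le _ _) _.
  apply: (@le_trans _ _ (loss_norm L * B)).
    apply: ler_pM => //; rewrite ?enorm_ge0 ?spectral_norm_ge0 //.
    exact: spectral_norm_mxcomb_le.
  by rewrite /GY /B mulrCA mulrA ler_wpM2r // ler_wpM2r ?(ltW lossN) //; lra.
have hG x v z : enorm x <= B -> Y v -> St z -> enorm (z - l x v) <= G1.
  move=> xB Yv [s' Ss <-]; apply: le_sup_gt0 G10 _; exists s', x, v; split=> //.
  by apply: le_trans xB _; rewrite /B ler_wpM2r //; lra.
have hresp w u : Y u -> forall e, 0 < e ->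
    exists2 x, X x & alpha * dotv x (mxcomb L w *m u) <= supportfun St w + e.
  move=> Yu e e0; have ea0 : 0 < e / alpha by rewrite divr_gt0.
  have [x Xx [z Sz hz]] := approachable_response w cvX S0 happ Yu ea0.
  exists x => //; rewrite -(dotv_loss _ _ _ hL).
  apply: le_trans (ler_wpM2l (ltW a0) hz) _.
  rewrite mulrDr mulrCA divff ?gt_eqF // mulr1 lerD2r -dotvZr.
  by apply: dotv_le_supportfun cSt _; exists z.
have rate : DY * GY / Num.sqrt N%:R <= eps by exact: accuracy_of_steps.
have hinner w u : eball 1 w -> Y u ->
    let xs := orun O (inner_average Y alpha RX mu N (mxcomb L w) u) in
    [/\ X xs.2, enorm xs.1 <= B, forall i, xs.2 i 0 <= xs.1 i 0 &
        forall v, Y v -> dotv w (l xs.1 v) <= supportfun St w + eps].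
  move=> w_1 Yu.
  have [Xs nx sx hx] := inner_averageP hX cvX hRX halpha hO cY cvY mu0 hDY
    (fun p => @hA w p w_1) (hresp w) N0 Yu.
  split=> // v Yv; rewrite (dotv_loss _ _ _ hL).
  apply: le_trans (hx v Yv) _; rewrite lerD2l balanced_step //.
have [x [hs hreg]] := @outer_loopP R n m d X Y l L St alpha RX eta mu B G1 eps N
  O u1 y sg eta0 cSt St0 hinner hG hsg T 0%N w1 hw1
  (fun i iT => conj (hu1 i iT) (hy i iT)).
rewrite -/algo -/s in hs.
split.
- by move=> t /hs[].
- pose lx := T%:R^-1 *: \sum_(t < T) l (x t) (y t).
  have [||z Sz hz] := @dist_le_of_support R d St lx (eps + 2 * G1 / Num.sqrt T%:R)
      cSt St0 (convex_scale_set cvS).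
  + by rewrite addr_ge0 ?divr_ge0 ?mulr_ge0 ?invr_ge0 ?ltW.
  + move=> w w_1; have := hreg w w_1.
    (* the initial point and the comparator are both in the unit ball *)
    have dw : dotv (w1 - w) (w1 - w) <= 2 ^+ 2.
      rewrite -enorm_le //; apply: le_trans (enorm_triangle _ _) _.
      by rewrite enormN; move: hw1 w_1; rewrite /eball /=; lra.
    under eq_bigr do rewrite add0n.
    rewrite sumrB sumr_const card_ord -[supportfun St w *+ T]mulr_natl -dotv_sumr.
    have -> : \sum_(t < T) l (x t) (y t) = T%:R *: lx.
      by rewrite scalerA divff ?scale1r ?gt_eqF.
    rewrite dotvZr -mulrBr => h.
    rewrite -(balanced_step (ltr0n R 2) G10 T0) -/eta.
    have eT0 : 0 < 2 * eta * T%:R by apply: mulr_gt0 => //; apply: mulr_gt0.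
    rewrite -(ler_pM2l eT0).
    have -> : 2 * eta * T%:R * (eps + (2 ^+ 2 / (T%:R * eta) + eta * G1 ^+ 2) / 2)
        = T%:R * (2 * eta * eps + eta ^+ 2 * G1 ^+ 2) + 2 ^+ 2.
      by field; rewrite !gt_eqF.
    lra.
  (* [l] is monotone in its first argument, being bilinear and nonnegative *)
  have low : forall i, (T%:R^-1 *: \sum_(t < T) l (s t) (y t)) i 0 <= lx i 0.
    move=> i; rewrite /lx !mxE ler_wpM2l ?invr_ge0 ?(ltW T0) // !summxE.
    apply: ler_sum => t _; have [Xs _ sx] := hs t (ltn_ord t).
    have xs0 : nonneg_vec (x t - s t) by move=> j; rewrite !mxE subr_ge0.
    have := hl _ _ xs0 (hY _ (hy t (ltn_ord t))) i.
    by rewrite linearBl !mxE subr_ge0.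
  apply: le_trans (eucl_dist_down_closure_le Sz low) _; apply: le_trans hz _.
  (* the two regrets add up to (2 G1 + 1) / sqrt T, two thirds of the claim *)
  have -> : eps + 2 * G1 / Num.sqrt T%:R = (4 * G1 + 2) / (2 * Num.sqrt T%:R).
    by rewrite /eps; field; rewrite gt_eqF.
  by rewrite ler_pM2r ?invr_gt0 ?mulr_gt0 //; lra.
move=> r1; rewrite ocalls_outer_loop natrM expr2 [X in _ <= _ * X]mulrA mulrA.
rewrite mulrC ler_wpM2r ?ltW //; lra.
Qed.
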